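(* Let $n\ge1$ and let $t$ be an integer with $t\geq \frac{n^3}{2}$, and let $a_n(t):=K_n(t,0,\ldots,0,-t)$. Then \[ (n-1)!\cdot\binom{t+n-1}{\binom{n}{2}}\prod_{i=0}^{n-2}C_i \;\geq\; a_n(t)\;\geq\;\binom{t+n-1}{\binom{n}{2}}\prod_{i=0}^{n-2}C_i . \]
   Context: For $\bm{N}=(N_0,\ldots,N_n)\in\mathbb{Z}^{n+1}$ with $\sum_iN_i=0$, $K_n(\bm{N})$ is the number of integer vectors $(f_{ij})_{0\le i<j\le n}\in\mathbb{Z}_{\ge0}^{\binom{n+1}{2}}$ with $\sum_{j>i} f_{ij}-\sum_{k<i} f_{ki}=N_i$ for all $i$. Here $(t,0,\ldots,0,-t)\in\mathbb{Z}^{n+1}$, and $C_i=\frac{1}{i+1}\binom{2i}{i}$ is the $i$-th Catalan number (so $C_0=1$). *)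

(* Defs.v *)
From mathcomp Require Import all_boot all_order all_algebra.
Set Implicit Arguments. Unset Strict Implicit. Unset Printing Implicit Defensive.
Import Order.TTheory GRing.Theory Num.Theory.
Local Open Scope ring_scope.

(* A flow vector (f_ij)_{0<=i<j<=n} is encoded as a finite function on
   pairs (i,j) of 'I_(n.+1), required to vanish when ~(i<j). *)
Definition flowvec (n : nat) := {ffun 'I_n.+1 * 'I_n.+1 -> nat}.

Definition is_flow (n : nat) (N : 'I_n.+1 -> int) (f : flowvec n) : Prop :=
  (forall i j : 'I_n.+1, ~~ (i < j)%N -> f (i, j) = 0%N) /\
  (forall i : 'I_n.+1,
     (\sum_(j : 'I_n.+1 | (i < j)%N) (f (i, j))%:Z)
     - (\sum_(k : 'I_n.+1 | (k < i)%N) (f (k, i))%:Z) = N i).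

(* s enumerates (without repetition) exactly the solutions; then K_n(N) = size s. *)
Definition enumerates_flows (n : nat) (N : 'I_n.+1 -> int) (s : seq (flowvec n)) : Prop :=
  uniq s /\ forall f : flowvec n, is_flow N f <-> f \in s.

Definition netflow_t (n : nat) (t : int) : 'I_n.+1 -> int :=
  fun i => if (i == 0%N :> nat) then t else if (i == n :> nat) then - t else 0.

Definition catalan (i : nat) : nat := ('C(i.*2, i) %/ i.+1)%N.

Definition catalan_prod (m : nat) : nat := (\prod_(0 <= i < m) catalan i)%N.

(* Main.v *)
Require Import Defs.
From mathcomp Require Import all_boot all_order all_algebra.
From mathcomp Require Import zify ring.
Import Order.TTheory GRing.Theory Num.Theory.
Local Open Scope ring_scope.

(** Write K_G(N) for the number of flows with netflow N on a graph G, and G_p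
    for the complete graph on 0, ..., p. Adding one edge e = (i, j) to G gives
    K_{G+e}(N) = K_G(N) + K_{G+e}(N - x_i + x_j), and every identity below is
    derived from this recurrence.

    Lidskii's formula, by induction on the edges of G_{n-1}, writes
    K_n(t,0,...,0,-t) as a sum of values of K_{G_{n-1}}, indexed by the subsets
    of a set of t + C(n,2) shifts, t+n-1 of which are shifts at vertex 0.
    Keeping only the latter yields the lower bound
    C(t+n-1, C(n,2)) v, and pushing all shifts to vertex 0, which can only
    increase K, the upper bound C(t+C(n,2), C(n,2)) v, with
    v = K_{n-1}(C(n,2)-(n-1), -(n-2), ..., -1, 0). For t >= n^3/2 the ratio of
    the two binomials is at most (n-1)!: split the C(n-1,2) unit steps between
    them into blocks of k = 1, ..., n-2 steps; a block of k steps costs at most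
    a factor k+1.

    The value v = C_0 ... C_{n-2} is a case of the Morris identity. Following
    Aomoto, let E_k be the sum over the k-subsets S of {1, ..., m} of the number
    of flows on G_m with demand m+1-i-[i in S] at vertex i >= 1. Writing
    conservation at i as an identity for the total flow carried by each edge and
    summing over S not containing i, everything cancels except
    (m-k)(m-k+1) E_k = (k+1)(2m-k) E_{k+1}. Hence E_0 = C_m E_m, while E_0 and
    E_m are the values v for n = m+2 and n = m+1. *)

(** * Vector partition functions *)

(** An additive functional with value [j - i] on the edge vector ['X^i - 'X^j], hence positive on
    every edge: it bounds multiplicities and supports inductions on the netflow. *)
Definition height (v : {poly int}) : int := - (v^`()).[1].

Lemma heightB (u v : {poly int}) : height (u - v) = height u - height v.
Proof. by rewrite /height derivB hornerD hornerN opprD opprK addrC. Qed.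

Lemma heightMn (v : {poly int}) (c : nat) : height (v *+ c) = height v * c%:Z.
Proof. by rewrite /height derivMn hornerMn mulNr -mulr_natr natz. Qed.

Lemma additive_mulrn (lam : {poly int} -> int) :
  {morph lam : u v / u - v} ->
  forall (u v : {poly int}) c, lam (u - v *+ c) = lam u - lam v * c%:Z.
Proof.
move=> lamB u v; elim=> [|c IHc]; first by rewrite mulr0n mulr0 !subr0.
rewrite mulrSr opprD addrA lamB IHc; lia.
Qed.

Definition positive (L : seq {poly int}) := all (fun v => 0 < height v) L.

(* Netflows are polynomials, the coefficient of 'X^i being the netflow at vertex
   i. The multiplicity of v in a decomposition of N cannot exceed the height of
   N, as all vectors of L are meant to have positive height. *)
Fixpoint kpf (L : seq {poly int}) (N : {poly int}) : nat :=
  if L is v :: L' then (\sum_(c < `|height N|.+1) kpf L' (N - v *+ c))%N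
  else (N == 0).

(** An additive functional that is nonnegative on [L] is nonnegative on all sums of members of [L].
    It is applied to the height, to single coefficients and to the value at 1. *)
Lemma kpf_lt0 (lam : {poly int} -> int) (L : seq {poly int}) (N : {poly int}) :
  {morph lam : u v / u - v} -> all (fun v => 0 <= lam v) L ->
  lam N < 0 -> kpf L N = 0%N.
Proof.
move=> lamB; elim: L N => [|v L IHL] N /=.
  move=> _; case: eqP => // ->.
  by have := lamB 0 0; rewrite subrr subrr => ->.
case/andP=> v_ge0 L_ge0 N_lt0; apply: big1 => c _; apply: IHL => //.
rewrite additive_mulrn //; nia.
Qed.

Lemma positive_ge0 (L : seq {poly int}) :
  positive L -> all (fun v => 0 <= height v) L.
Proof. by apply: sub_all => v; apply: ltW. Qed.

(** Terms with [c] above the height of [N] vanish, so any larger cutoff will do, and several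
    netflows can share one. *)
Lemma kpf_bound (B : nat) (v : {poly int}) (L : seq {poly int}) (N : {poly int}) :
  positive (v :: L) -> height N < B%:Z ->
  kpf (v :: L) N = (\sum_(c < B) kpf L (N - v *+ c))%N.
Proof.
case/andP=> v_gt0 posL ltNB.
have tail c : height N < c%:Z -> kpf L (N - v *+ c) = 0%N.
  move=> ltNc; apply: (kpf_lt0 height) => //; first exact: heightB.
    exact: positive_ge0.
  rewrite additive_mulrn; first nia.
  exact: heightB.
rewrite /= -(big_mkord xpredT (fun c => kpf L (N - v *+ c))).
rewrite -(big_mkord xpredT (fun c => kpf L (N - v *+ c))).
have [leB | ltB] := leqP B `|height N|.+1.
  rewrite (big_cat_nat (leq0n _) leB) //= [X in (_ + X)%N]big_nat_cond [X in (_ + X)%N]big1 ?addn0 // => c.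
  by rewrite andbT => /andP[leBc _]; apply: tail; lia.
rewrite [RHS](big_cat_nat (leq0n _) (ltnW ltB)) //= [X in (_ + X)%N]big_nat_cond.
rewrite [X in (_ + X)%N]big1 ?addn0 // => c.
by rewrite andbT => /andP[leBc _]; apply: tail; lia.
Qed.

Lemma kpf_cons (v : {poly int}) (L : seq {poly int}) (N : {poly int}) :
  positive (v :: L) -> kpf (v :: L) N = (kpf L N + kpf (v :: L) (N - v))%N.
Proof.
move=> posL; have v_gt0 : 0 < height v by case/andP: posL.
(* One term more than in the definition: once [c = 0] is split off, the range agrees with the one
   taken for [N - v]. *)
rewrite (@kpf_bound `|height N|.+2) //; last lia.
rewrite (@kpf_bound `|height N|.+1 v L (N - v)) //; last by rewrite heightB; lia.
rewrite big_ord_recl /= mulr0n subr0; congr addn.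
by apply: eq_bigr => c _; rewrite mulrS opprD addrA.
Qed.

Lemma kpf_swap (v w : {poly int}) (L : seq {poly int}) (N : {poly int}) :
  positive (v :: w :: L) -> kpf (v :: w :: L) N = kpf (w :: v :: L) N.
Proof.
move=> /[dup] posvw /and3P[v_gt0 w_gt0 posL].
have expand x y : 0 < height x -> 0 < height y -> kpf (x :: y :: L) N =
    (\sum_(c < `|height N|.+1) \sum_(d < `|height N|.+1)
       kpf L (N - x *+ c - y *+ d))%N.
  move=> x_gt0 y_gt0; rewrite (@kpf_bound `|height N|.+1) /=; last lia.
    apply: eq_bigr => c _; apply: (@kpf_bound `|height N|.+1).
      by rewrite /= y_gt0.
    rewrite additive_mulrn; [nia | exact: heightB].
  by rewrite x_gt0 y_gt0.
rewrite !expand // exchange_big; apply: eq_bigr => c _; apply: eq_bigr => d _.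
by rewrite addrAC.
Qed.

Lemma eq_kpf_cons (v : {poly int}) (L M : seq {poly int}) :
  kpf L =1 kpf M -> kpf (v :: L) =1 kpf (v :: M).
Proof. by move=> eqLM N /=; apply: eq_bigr => c _. Qed.

Arguments kpf : simpl never.

Lemma kpf_catCA (v : {poly int}) (L M : seq {poly int}) :
  positive (L ++ v :: M) -> kpf (L ++ v :: M) =1 kpf (v :: L ++ M).
Proof.
elim: L => [//|w L IHL] posL N; have /andP[w_gt0 posL'] := posL.
rewrite (eq_kpf_cons w (L ++ v :: M) (v :: L ++ M) (IHL posL') N
          : kpf ((w :: L) ++ v :: M) N = _) kpf_swap //.
by move: posL; rewrite /positive /= !all_cat /= => /and4P[-> -> -> ->].
Qed.

Lemma perm_kpf (L M : seq {poly int}) :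
  positive L -> perm_eq L M -> kpf L =1 kpf M.
Proof.
elim: L M => [|v L IHL] M.
  by move=> _; rewrite perm_sym => /perm_nilP->.
move=> posL permM.
have vM : v \in M by rewrite -(perm_mem permM) mem_head.
have posM : positive M by rewrite /positive -(perm_all _ permM).
case/splitPr: vM permM posM => M1 M2 permM posM N.
rewrite kpf_catCA //; apply: eq_kpf_cons; apply: IHL.
  by case/andP: posL.
by move: permM; rewrite -(cat1s v M2) perm_sym perm_catCA /= perm_cons perm_sym.
Qed.

Lemma kpf_ge_sub (v : {poly int}) (L : seq {poly int}) (N : {poly int}) :
  positive L -> v \in L -> (kpf L (N - v) <= kpf L N)%N.
Proof.
move=> posL vL; have permL := perm_to_rem vL.
rewrite !(perm_kpf _ _ posL permL) [X in (_ <= X)%N]kpf_cons ?leq_addl //.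
by rewrite /positive -(perm_all _ permL).
Qed.

(** A netflow on the face [lam = 0] has no decomposition that uses a vector with [lam > 0]. *)
Lemma kpf_cat_face (lam : {poly int} -> int) (L M : seq {poly int}) (N : {poly int}) :
  {morph lam : u v / u - v} -> positive (L ++ M) ->
  all (fun v => 0 < lam v) L -> all (fun v => 0 <= lam v) M ->
  lam N = 0 -> kpf (L ++ M) N = kpf M N.
Proof.
move=> lamB posLM lamL lamM lamN0; elim: L posLM lamL => [//|v L IHL] posvL.
case/andP=> lamv lamL; rewrite kpf_cons // (kpf_lt0 lam _ (N - v)) //.
- by rewrite addn0 IHL //; case/andP: posvL.
- rewrite /= (ltW lamv) all_cat lamM andbT.
  by apply: sub_all lamL => w; apply: ltW.
- by rewrite lamB lamN0; lia.
Qed.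

(* Coefficient form of the Leibniz rule for the product of the 1/(1 - x^e): the
   term kpf (e :: L) (N - e) is the total multiplicity of e over all
   decompositions of N. *)
Lemma kpf_derivative (lam : {poly int} -> int) (L : seq {poly int}) (N : {poly int}) :
  {morph lam : u v / u - v} -> positive L ->
  lam N * (kpf L N)%:Z = \sum_(e <- L) lam e * (kpf (e :: L) (N - e))%:Z.
Proof.
move=> lamB; elim: L N => [|v L IHL] N posL.
  rewrite big_nil /kpf; case: eqP => [->|_]; last by rewrite mulr0.
  by have := lamB 0 0; rewrite subrr subrr => ->; rewrite mul0r.
have /andP[v_gt0 posL'] := posL.
(* Decompositions avoiding [v] are covered by the induction on [L]; those using [v] come from
   [N - v], which has smaller height. *)
have [n ltNn] : exists n : nat, height N < n%:Z by exists `|height N|.+1; lia.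
elim: n N ltNn => [|n IHn] N ltNn.
  have vanish M e : height M < 0 -> e \in v :: L -> kpf (v :: L) M = 0%N /\ kpf (e :: v :: L) M = 0%N.
    move=> M_lt0 eL; split; apply: (kpf_lt0 height) => //;
      try exact: heightB; apply: positive_ge0 => //.
    by rewrite /positive /= (allP posL e eL).
  have [-> _] := vanish N v ltNn (mem_head _ _).
  rewrite mulr0 big_seq big1 // => e eL.
  have [|_ ->] := vanish (N - e) e _ eL; last by rewrite mulr0.
  by rewrite heightB; have := allP posL e eL => /=; lia.
have IHNv : lam (N - v) * (kpf (v :: L) (N - v))%:Z =
    \sum_(e <- v :: L) lam e * (kpf (e :: v :: L) (N - v - e))%:Z.
  by apply: IHn; rewrite heightB; lia.
rewrite lamB in IHNv.
rewrite !big_cons in IHNv *.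
rewrite (kpf_cons v L N) // PoszD (kpf_cons v (v :: L)); last by rewrite /positive /= v_gt0.
have step e : e \in L -> lam e * (kpf (e :: v :: L) (N - e))%:Z =
    lam e * (kpf (e :: L) (N - e))%:Z + lam e * (kpf (e :: v :: L) (N - v - e))%:Z.
  move=> eL; have e_gt0 : 0 < height e by apply: (allP posL'); exact: eL.
  have pos_ve : positive (v :: e :: L) by rewrite /= v_gt0 e_gt0.
  rewrite -(kpf_swap v e L) // (kpf_cons v (e :: L)) // PoszD mulrDr.
  by rewrite (kpf_swap v e L) // addrAC.
rewrite big_seq (eq_bigr _ step) -big_seq big_split /= -IHL //.
rewrite PoszD !mulrDr; move: IHNv; rewrite mulrBl => /eqP; rewrite subr_eq => /eqP ->.
ring.
Qed.

(** * Lidskii's formula *)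

Definition edge (e : nat * nat) : {poly int} := 'X^(e.1) - 'X^(e.2).

Lemma height_edge (e : nat * nat) : height (edge e) = e.2%:Z - e.1%:Z.
Proof. by rewrite /height /edge derivB !derivXn hornerD hornerN !hornerMn !hornerXn !expr1n opprB -!(natz _). Qed.

Lemma coef_edge (e : nat * nat) (i : nat) :
  (edge e)`_i = (i == e.1)%:R - (i == e.2)%:R.
Proof. by rewrite coefB !coefXn. Qed.

Lemma horner1_edge (e : nat * nat) : (edge e).[1] = 0.
Proof. by rewrite !hornerE !expr1n subrr. Qed.

Lemma positive_edges (G : seq (nat * nat)) :
  positive (map edge G) = all (fun e => (e.1 < e.2)%N) G.
Proof.
rewrite /positive all_map; apply: eq_all => e /=.
by rewrite height_edge subr_gt0 ltz_nat.
Qed.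

(** The value at 1 is the total netflow, which is 0 on every edge. *)
Lemma kpf_sum_neq0 (G : seq (nat * nat)) (N : {poly int}) :
  N.[1] != 0 -> kpf (map edge G) N = 0%N.
Proof.
rewrite neq_lt => /orP[] N1.
  apply: (kpf_lt0 (fun u => u.[1])) => //; first by move=> u v; rewrite hornerD hornerN.
  by apply/allP => _ /mapP[e _ ->]; rewrite horner1_edge.
apply: (kpf_lt0 (fun u => - u.[1])) => //; last by rewrite oppr_lt0.
  by move=> u v; rewrite !hornerE opprD.
by apply/allP => _ /mapP[e _ ->]; rewrite horner1_edge oppr0.
Qed.

(** Sums [phi] over all selections of positions in [U], each selected position raising the netflow
    at its vertex by one; equal entries are distinct positions. *)
Fixpoint shifts (U : seq nat) (phi : {poly int} -> nat) (N : {poly int}) : nat :=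
  if U is i :: U' then (shifts U' phi N + shifts U' phi (N + 'X^i))%N else phi N.

Lemma perm_shifts (U V : seq nat) (phi : {poly int} -> nat) :
  perm_eq U V -> shifts U phi =1 shifts V phi.
Proof.
have CA i W1 W2 : shifts (W1 ++ i :: W2) phi =1 shifts (i :: W1 ++ W2) phi.
  by elim: W1 => [//|j W1 IHW] N; rewrite /= !IHW /= addnACA (addrAC N 'X^j).
elim: U V => [|i U IHU] V; first by rewrite perm_sym => /perm_nilP->.
move=> permV; have iV : i \in V by rewrite -(perm_mem permV) mem_head.
case/splitPr: iV permV => V1 V2 permV N; rewrite CA /=.
have permU : perm_eq U (V1 ++ V2).
  by move: permV; rewrite -(cat1s i V2) perm_sym perm_catCA /= perm_cons perm_sym.
by rewrite !(IHU _ permU).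
Qed.

Lemma shifts_kpf_cons (U : seq nat) (v : {poly int}) (L : seq {poly int}) (N : {poly int}) :
  positive (v :: L) ->
  shifts U (kpf (v :: L)) N = (shifts U (kpf L) N + shifts U (kpf (v :: L)) (N - v))%N.
Proof.
move=> posL; elim: U N => [|i U IHU] N; first exact: kpf_cons.
by rewrite /= (IHU N) (IHU (N + 'X^i)) (addrAC N 'X^i) addnACA.
Qed.

(** A selection raises the coefficient at [i] by at most the multiplicity of [i] in [U]. *)
Lemma shifts_coef_lt0 (i : nat) (U : seq nat) (phi : {poly int} -> nat) (N : {poly int}) :
  (forall M : {poly int}, M`_i < 0 -> phi M = 0%N) ->
  N`_i + (count_mem i U)%:Z < 0 -> shifts U phi N = 0%N.
Proof.
move=> phi0; elim: U N => [|j U IHU] N /=; first by rewrite addr0; apply: phi0.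
move=> ltN; rewrite !IHU // ?coefD ?coefXn; move: ltN; rewrite PoszD eq_sym; case: eqP => _ /=; lia.
Qed.

Definition sinks (n : nat) : seq (nat * nat) := [seq (l, n) | l <- iota 0 n].

Lemma coef_sum_edge (n i : nat) (al : seq nat) :
  (i < n)%N -> (\sum_(l <- al) edge (l, n))`_i = (count_mem i al)%:Z.
Proof.
move=> ltin; rewrite coef_sum; elim: al => [|l al IHal]; first by rewrite big_nil.
rewrite big_cons IHal /= coef_edge /= PoszD (ltn_eqF ltin) eq_sym subr0.
by case: eqP.
Qed.

(** The flow on a star is forced: the edge from [l] carries as many units as [l] has occurrences in
    [al]. *)
Lemma kpf_sinks (n : nat) (s al : seq nat) :
  uniq s -> all (fun l => (l < n)%N) s -> {subset al <= s} ->
  kpf [seq edge (l, n) | l <- s] (\sum_(l <- al) edge (l, n)) = 1%N.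
Proof.
elim: s al => [|i s IHs] al.
  by case: al => [|l al] _ _ sub; [rewrite /= big_nil /kpf eqxx | have := sub l (mem_head _ _)].
case/andP=> i_s uniq_s /andP[ltin lts].
have [c] := ubnP (count_mem i al); elim: c al => // c IHc al ltc sub.
have posL : positive [seq edge (l, n) | l <- i :: s].
  rewrite map_comp positive_edges all_map /=; apply/andP; split=> //.
have lamB : {morph (fun u : {poly int} => - u`_i) : u v / u - v}.
  by move=> u v; rewrite coefB opprD.
rewrite /= kpf_cons //; have [i_al | i_al] := boolP (i \in al).
  rewrite (kpf_lt0 _ _ _ lamB); first 1 last.
  - apply/allP => _ /mapP[l ls ->]; rewrite coef_edge /= (ltn_eqF ltin) subr0.
    by case: eqP => // eil; rewrite eil ls in i_s.
  - by rewrite coef_sum_edge // oppr_lt0 ltz_nat -has_count has_pred1.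
  rewrite (perm_big _ (perm_to_rem i_al)) big_cons /= addrC addrK.
  apply: IHc.
    have := perm_to_rem i_al => /permP/(_ (pred1 i)) /=; rewrite eqxx => eqC.
    by move: ltc; rewrite eqC.
  by move=> l /mem_rem; apply: sub.
rewrite IHs //; last first.
  move=> l lal; have := sub l lal; rewrite inE => /predU1P[eli | //].
  by rewrite -eli lal in i_al.
rewrite (kpf_lt0 (fun u => u`_i)) //.
- by move=> u v; rewrite coefB.
- apply/allP => _ /(mapP (f := fun l => edge (l, n)) (s := i :: s))[l ls ->].
  by rewrite coef_edge /= (ltn_eqF ltin) subr0; case: eqP.
- rewrite coefB coef_sum_edge // coef_edge /= eqxx (ltn_eqF ltin) (count_memPn i_al).
  by [].
Qed.

Lemma shifts_kpf_nil (U : seq nat) (N : {poly int}) :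
  0 < N.[1] -> shifts U (kpf [::]) N = 0%N.
Proof.
elim: U N => [|i U IHU] N N_gt0 /=.
  by rewrite /kpf; case: eqP => // N0; rewrite N0 horner0 in N_gt0.
rewrite !IHU // hornerD hornerXn expr1n; lia.
Qed.

(* The pairwise condition says that no later edge enters the source of an earlier
   one, so that K vanishes when the netflow at that source is negative. *)
Lemma lidskii (n : nat) (G : seq (nat * nat)) (al : seq nat) :
  pairwise (fun e g => g.2 != e.1) G ->
  all (fun e => (e.1 < e.2 < n)%N) G -> all (fun l => (l < n)%N) al ->
  kpf (map edge (G ++ sinks n)) (\sum_(l <- al) edge (l, n)) =
  shifts (al ++ map fst G) (kpf (map edge G)) (- \sum_(g <- G) 'X^(g.1)).
Proof.
elim: G al => [|[i k] G IHG] al.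
  (* Without inner edges both sides are 1: the flow on the star is unique, and only the empty
     selection of shifts leaves the netflow 0. *)
  move=> _ _ alP; rewrite /= big_nil oppr0 cats0 -map_comp kpf_sinks ?iota_uniq //.
  - elim: al {alP} => [|l al IHal]; first by rewrite /kpf /= eqxx.
    by rewrite /= -IHal shifts_kpf_nil // !hornerE expr1n.
  - by apply/allP => l; rewrite mem_iota.
  - by move=> l /(allP alP); rewrite mem_iota.
rewrite pairwise_cons => /andP[iG pairG].
case/andP=> /andP[ltik ltkn] G_lt al_lt; move: al_lt; rewrite /= in ltik ltkn.
have ltin := ltn_trans ltik ltkn.
have posE : positive (map edge ((i, k) :: G ++ sinks n)).
  rewrite positive_edges /= ltik /= all_cat; apply/andP; split.
    by move: G_lt; apply: sub_all => e /andP[].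
  by rewrite all_map; apply/allP => l; rewrite mem_iota.
have posG : positive (map edge ((i, k) :: G)).
  by move: posE; rewrite !positive_edges /= all_cat => /and3P[-> ->].
(* By the pairwise condition no edge enters [i]. *)
have coef_i : all (fun v : {poly int} => 0 <= v`_i) (map edge ((i, k) :: G ++ sinks n)).
  apply/allP => _ /mapP[e eG ->]; rewrite coef_edge.
  suff /negPf-> : i != e.2 by rewrite subr0; case: eqP.
  move: eG; rewrite inE mem_cat => /predU1P[->|/orP[eG|/mapP[l _ ->]]] /=.
  - by rewrite ltn_eqF.
  - by rewrite eq_sym (allP iG).
  - by rewrite ltn_eqF.
have coefB' : {morph (fun u : {poly int} => u`_i) : u v / u - v}.
  by move=> u v; rewrite coefB.
(* Each unit sent along [(i, k)] replaces an occurrence of [i] in [al] by [k], so the number of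
   occurrences of [i] decreases. *)
have [c] := ubnP (count_mem i al); elim: c al => // c IHc al ltc al_lt.
pose o : {poly int} := \sum_(g <- G) 'X^(g.1).
have permU : perm_eq (al ++ i :: map fst G) (i :: al ++ map fst G).
  by rewrite -(cat1s i (map _ _)) perm_catCA.
rewrite /= kpf_cons // IHG // (perm_shifts _ _ _ permU) /= big_cons /= -/o.
have -> : - ('X^i + o) + 'X^i = - o by ring.
rewrite (opprD 'X^i o) (shifts_kpf_cons _ _ (map edge G) (- o)) //.
(* The flows avoiding [(i, k)] match by induction on [G]. The two remaining terms on the right
   differ by ['X^k]: together they are a sum of shifts with an extra position [k]. *)
rewrite addnCA; congr addn.
have -> : - o - edge (i, k) = - 'X^i - o + 'X^k by rewrite /edge /=; ring.
(* With no unit available at [i], using [(i, k)] makes the netflow at [i] negative, and both sides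
   vanish. *)
have [i_al | i_al] := boolP (i \in al); last first.
  rewrite (kpf_lt0 _ _ _ coefB' coef_i); last first.
    by rewrite coefB coef_sum_edge // coef_edge /= eqxx (ltn_eqF ltik) (count_memPn i_al).
  have phi0 (M : {poly int}) : M`_i < 0 -> kpf (map edge ((i, k) :: G)) M = 0%N.
    apply: (kpf_lt0 _ _ _ coefB').
    by move: coef_i; rewrite -cat_cons map_cat all_cat => /andP[].
  have oi : o`_i = (count_mem i (map fst G))%:Z.
    rewrite /o coef_sum; elim: (G) => [|g G' IH]; first by rewrite big_nil.
    rewrite big_cons IH /= coefXn PoszD eq_sym.
    by case: eqP.
  by rewrite !(shifts_coef_lt0 i) // ?coefD ?coefN ?coefXn oi count_cat (count_memPn i_al) ?eqxx ?(ltn_eqF ltik) /=; lia.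
have rem_lt : all (fun l => (l < n)%N) (k :: rem i al).
  by rewrite /= ltkn; apply/allP => l /mem_rem; apply: (allP al_lt).
have sum_rem : \sum_(l <- al) edge (l, n) - edge (i, k) =
    \sum_(l <- k :: rem i al) edge (l, n).
  rewrite (perm_big _ (perm_to_rem i_al)) !big_cons /edge /=; ring.
have := IHc (k :: rem i al); rewrite /= -/(map edge _) sum_rem => -> //; last first.
  have := perm_to_rem i_al => /permP/(_ (pred1 i)) /=; rewrite eqxx => eqC.
  by move: ltc; rewrite eqC (gtn_eqF ltik).
rewrite big_cons /= -/o opprD; congr addn; apply: perm_shifts.
  rewrite -(cat1s i (map _ _)) perm_catCA /= -cat_cons perm_cat2r perm_sym.
  exact: perm_to_rem.
rewrite -(cat1s i (map _ _)) perm_catCA /= -cat_cons perm_cat2r perm_sym.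
exact: perm_to_rem.
Qed.

Lemma leq_shifts_cat (U V : seq nat) (phi : {poly int} -> nat) (N : {poly int}) :
  (shifts U phi N <= shifts (V ++ U) phi N)%N.
Proof. by elim: V => //= i V IHV; apply: leq_trans IHV (leq_addr _ _). Qed.

Lemma leq_shifts_nseq (i : nat) (U : seq nat) (phi : {poly int} -> nat) (N : {poly int}) :
  (forall l, l \in U -> forall M, (phi (M + 'X^l)%R <= phi (M + 'X^i)%R)%N) ->
  (shifts U phi N <= shifts (nseq (size U) i) phi N)%N.
Proof.
have mono V x y : (forall M, (phi (M + x)%R <= phi (M + y)%R)%N) ->
    forall M, (shifts V phi (M + x)%R <= shifts V phi (M + y)%R)%N.
  move=> le_xy; elim: V => //= l V IHV M.
  by rewrite !(addrAC M _ 'X^l) leq_add.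
elim: U N => //= l U IHU N le_li.
have le_U j : j \in U -> forall M, (phi (M + 'X^j)%R <= phi (M + 'X^i)%R)%N.
  by move=> jU; apply: le_li; rewrite inE jU orbT.
rewrite leq_add ?IHU //; apply: leq_trans (IHU _ le_U) (mono _ _ _ _ _).
by apply: le_li; rewrite mem_head.
Qed.

(** Only selections of exactly [b] positions balance the total netflow, and they all give the same
    value. *)
Lemma shifts_nseq (b r i : nat) (phi : {poly int} -> nat) (N : {poly int}) :
  (forall M : {poly int}, M.[1] != 0 -> phi M = 0%N) -> N.[1] = - b%:Z ->
  shifts (nseq r i) phi N = ('C(r, b) * phi (N + 'X^i *+ b)%R)%N.
Proof.
move=> phi0.
have shifts0 s M : 0 < M.[1] -> shifts (nseq s i) phi M = 0%N.
  elim: s M => [|s IHs] M M_gt0 /=; first by rewrite phi0 ?gt_eqF.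
  by rewrite !IHs // hornerD hornerXn expr1n; lia.
elim: r b N => [|r IHr] [|b] N N1 /=.
- by rewrite mulr0n addr0 mul1n.
- by rewrite mul0n phi0 // N1; lia.
- rewrite (IHr 0%N) // shifts0 ?bin0 ?addn0 //.
  by rewrite hornerD hornerXn expr1n N1.
- rewrite (IHr b.+1) // (IHr b) ?binS ?mulnDl ?mulrS ?addrA //.
  by rewrite hornerD hornerXn expr1n N1; lia.
Qed.

(** * The complete graph and the two bounds on its flow count *)

Definition edges (p : nat) : seq (nat * nat) :=
  [seq (i, j) | i <- iota 0 p.+1, j <- iota i.+1 (p - i)].

Arguments edges : simpl never.

Lemma mem_edges (p : nat) (e : nat * nat) : (e \in edges p) = (e.1 < e.2 <= p)%N.
Proof.
case: e => i j; apply/allpairsPdep/idP => [[a [c [ha hc [-> ->]]]]|ltij].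
  by move: ha hc; rewrite !mem_iota /=; lia.
by rewrite /= in ltij; exists i, j; split=> //; rewrite mem_iota; lia.
Qed.

Lemma uniq_edges (p : nat) : uniq (edges p).
Proof.
apply: allpairs_uniq_dep; first exact: iota_uniq.
  by move=> i _; apply: iota_uniq.
by move=> [i j] [k l] _ _ /= [-> ->].
Qed.

Lemma perm_edgesS (p : nat) : perm_eq (edges p.+1) (edges p ++ sinks p.+1).
Proof.
apply: uniq_perm; first exact: uniq_edges.
  rewrite cat_uniq uniq_edges map_inj_uniq ?iota_uniq; last by move=> i j [].
  rewrite andbT -all_predC; apply/allP => _ /mapP[l _ ->] /=.
  by rewrite mem_edges /=; lia.
move=> [i j]; rewrite [RHS]mem_cat !mem_edges /=.
apply/idP/orP => [ltij | [ltij|/mapP[l]]].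
- have [->|neq] := eqVneq j p.+1; last by left; lia.
  by right; apply/mapP; exists i => //; rewrite mem_iota; lia.
- lia.
- by rewrite mem_iota => ltl [-> ->]; lia.
Qed.

Lemma size_edges (p : nat) : size (edges p) = 'C(p.+1, 2).
Proof.
elim: p => [//|p IHp]; rewrite (perm_size (perm_edgesS p)) size_cat IHp.
by rewrite size_map size_iota [RHS]binS bin1.
Qed.

Lemma count0_edges (p : nat) : count_mem 0%N (map fst (edges p)) = p.
Proof.
elim: p => [//|p IHp].
have /permP-> : perm_eq (map fst (edges p.+1)) (map fst (edges p ++ sinks p.+1)).
  by apply: perm_map; apply: perm_edgesS.
rewrite map_cat count_cat IHp -map_comp /= map_id_in //.
rewrite (count_memPn _) ?addn1 // mem_iota; lia.
Qed.

Lemma positive_edges_seq (p : nat) : positive (map edge (edges p)).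
Proof. by rewrite positive_edges; apply/allP => e; rewrite mem_edges => /andP[]. Qed.

(** The netflow of the value v of the overview for n = p + 1: what remains when all C(p+1, 2) unit
    shifts are placed at vertex 0. *)
Definition source_flow (p : nat) : {poly int} :=
  \sum_(e <- edges p) ('X^0 - 'X^(e.1)).

Lemma eq_shifts (U : seq nat) (phi psi : {poly int} -> nat) :
  phi =1 psi -> shifts U phi =1 shifts U psi.
Proof. by move=> eq_phi; elim: U => //= i U IHU N; rewrite !IHU. Qed.

(** A later edge starts no lower than an earlier one and ends strictly above its own start, so it
    cannot enter the earlier source. *)
Lemma pairwise_tail_neq_head (G : seq (nat * nat)) :
  sorted (relpre fst leq) G -> all (fun e => (e.1 < e.2)%N) G ->
  pairwise (fun e g => g.2 != e.1) G.
Proof.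
rewrite sorted_pairwise; last by move=> e f g /=; apply: leq_trans.
elim: G => //= e G IHG /andP[leG sortG] /andP[_ ltG].
rewrite IHG // andbT; apply/allP => g gG.
by have /= := allP leG g gG; have /= := allP ltG g gG; lia.
Qed.

Lemma kpf_source_edges (p t : nat) :
  kpf (map edge (edges p.+1)) (edge (0, p.+1)%N *+ t) =
  shifts (nseq t 0%N ++ map fst (edges p)) (kpf (map edge (edges p)))
    (- \sum_(e <- edges p) 'X^(e.1)).
Proof.
(* Sorting by source gives the edge order that [lidskii] requires; [kpf] does not depend on the
   order. *)
pose G := sort (relpre fst leq) (edges p).
have permG : perm_eq G (edges p) by rewrite perm_sort.
have permGS : perm_eq (edges p.+1) (G ++ sinks p.+1).
  by apply: perm_trans (perm_edgesS p) _; rewrite perm_cat2r perm_sym.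
have memG e : (e \in G) = (e.1 < e.2 <= p)%N by rewrite (perm_mem permG) mem_edges.
rewrite (perm_kpf _ _ (positive_edges_seq _) (perm_map edge permGS)).
have -> : edge (0, p.+1)%N *+ t = \sum_(l <- nseq t 0%N) edge (l, p.+1).
  by rewrite big_nseq -Monoid.iteropE.
rewrite lidskii.
- rewrite (perm_big _ permG) /= (perm_shifts _ _ _ (_ : perm_eq _ (nseq t 0%N ++ map fst (edges p)))).
    by apply: eq_shifts; apply: perm_kpf; rewrite ?perm_map // positive_edges; apply/allP => e; rewrite memG => /andP[].
  by rewrite perm_cat2l perm_map.
- apply: pairwise_tail_neq_head; first by apply: sort_sorted => e g; apply: leq_total.
  by apply/allP => e; rewrite memG => /andP[].
- by apply/allP => e; rewrite memG ltnS.
- by apply/allP => l /nseqP[->].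
Qed.

Lemma kpf_edges_bounds (p t : nat) (b := 'C(p.+1, 2))
    (v := kpf (map edge (edges p)) (source_flow p)) :
  ('C(t + p, b) * v <= kpf (map edge (edges p.+1)) (edge (0, p.+1)%N *+ t) <=
     'C(t + b, b) * v)%N.
Proof.
set o : {poly int} := \sum_(e <- edges p) 'X^(e.1).
have conc r : shifts (nseq r 0%N) (kpf (map edge (edges p))) (- o) = ('C(r, b) * v)%N.
  rewrite (shifts_nseq b).
  - rewrite /v /source_flow sumrB -/o big_const_seq count_predT size_edges.
    by rewrite addrC -Monoid.iteropE.
  - by move=> M; apply: kpf_sum_neq0.
  - rewrite hornerN horner_sum (eq_bigr (fun => 1)); last first.
      by move=> e _; rewrite hornerXn expr1n.
    by rewrite big_const_seq count_predT size_edges -Monoid.iteropE; congr (- _); apply: natz.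
rewrite kpf_source_edges -/o; apply/andP; split.
  (* Lower bound: keep only the selections among the positions at vertex 0, namely [t] copies and
     the sources of the [p] edges leaving 0. *)
  rewrite -conc; have /permPl := perm_filterC (pred1 0%N) (map fst (edges p)).
  rewrite perm_sym => permF.
  have permU : perm_eq (nseq t 0%N ++ map fst (edges p))
      (filter (predC (pred1 0%N)) (map fst (edges p)) ++ nseq (t + p) 0%N).
    rewrite perm_sym perm_catC nseqD -catA perm_cat2l perm_sym.
    apply: perm_trans permF _; rewrite perm_cat2r.
    by rewrite (all_pred1P _ _ (filter_all (pred1 0%N) _)) size_filter count0_edges.
  by rewrite (perm_shifts _ _ _ permU) leq_shifts_cat.
have szU : size (nseq t 0%N ++ map fst (edges p)) = (t + b)%N.
  by rewrite size_cat size_nseq size_map size_edges.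
rewrite -conc -szU; apply: leq_shifts_nseq => l; rewrite mem_cat => lU M.
have [->//|l_gt0] := posnP l.
have le_lp : (l < p)%N.
  case/orP: lU => [/nseqP[l0]|/mapP[e]]; first by rewrite l0 in l_gt0.
  by rewrite mem_edges => /andP[lte lep] ->; apply: leq_trans lep.
(* Moving a shift from [l] to 0 adds the vector of the edge [(0, l)], and adding an edge vector of
   the graph cannot decrease the count. *)
have -> : M + 'X^l = M + 'X^0 - edge (0, l)%N by rewrite /edge /=; ring.
apply: kpf_ge_sub; first exact: positive_edges_seq.
by rewrite map_f // mem_edges /= l_gt0 ltnW.
Qed.

(** * Aomoto's recurrence *)

(** Both the vertex weights and the exchanges along edges produce this number, so it cancels in
    [subset_recurrence]. *)
Definition ascents {m : nat} (U : {set 'I_m}) : nat :=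
  (\sum_(i : 'I_m | i \notin U) \sum_(j : 'I_m | j \in U) (i < j))%N.

Lemma sum_pairs_le (m : nat) (A : pred 'I_m) :
  (2 * \sum_(i | A i) \sum_(j | A j) (i <= j)%N = #|A| * #|A|.+1)%N.
Proof.
rewrite mul2n -addnn {1}exchange_big -big_split /= (eq_bigr (fun => #|A|.+1)).
  by rewrite sum_nat_const.
move=> i Ai; rewrite -big_split /= (eq_bigr (fun j => (1 + (j == i))%N)); last first.
  move=> j _; rewrite -val_eqE /=; case: ltngtP => //.
rewrite big_split /= sum1_card -addn1; congr addn.
rewrite (bigD1 i) //= eqxx big1 // => j /andP[_ /negPf ->] //.
Qed.

(** The weight [m - i] counts the [j >= i]: those outside [U] add up to a triangular number, those
    in [U] to the ascents. *)
Lemma sum_complement_weights (m : nat) (U : {set 'I_m}) :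
  (2 * \sum_(i : 'I_m | i \notin U) (m - i) =
   (m - #|U|) * (m - #|U|).+1 + 2 * ascents U)%N.
Proof.
have -> : (m - #|U| = #|[predC U]|)%N by rewrite -[X in (X - _)%N](card_ord m) -(cardC U) addKn.
rewrite -sum_pairs_le addnC -mulnDr -big_split /=; congr (2 * _)%N.
apply: eq_bigr => i iU.
have -> : (m - i = \sum_(j < m) (i <= j)%N)%N.
  rewrite -(big_mkord xpredT (fun j => (i <= j)%N : nat)) (big_cat_nat (leq0n i) (ltnW (ltn_ord i))) /=.
  rewrite big_nat_cond big1 ?add0n; last by move=> j; rewrite andbT; case: leqP => //; lia.
  rewrite big_nat_cond (eq_bigr (fun => 1%N)); last by move=> j; rewrite andbT => /andP[->].
  by rewrite -big_nat_cond sum_nat_const_nat muln1.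
rewrite (bigID (mem U)) /=; congr addn.
apply: eq_bigr => j jU; rewrite leq_eqVlt; case: eqP => // /val_inj eij.
by rewrite eij jU in iU.
Qed.

(** The weights total m(m+1)/2, by the previous lemma for the empty set; the complement's share is
    subtracted. *)
Lemma sum_weights (m : nat) (U : {set 'I_m}) :
  (2 * (\sum_(i in U) (m - i) + ascents U) = #|U| * (m + (m - #|U|).+1))%N.
Proof.
have all_w : (2 * \sum_(i < m) (m - i) = m * m.+1)%N.
  have := sum_complement_weights m set0.
  rewrite cards0 subn0 /ascents [X in (_ + 2 * X)%N]big1; last first.
    by move=> i _; rewrite big_pred0 // => j; rewrite inE.
  by rewrite muln0 addn0 => <-; congr (2 * _)%N; apply: eq_bigl => i; rewrite inE.
move: all_w; rewrite (bigID (mem U)) /= mulnDr sum_complement_weights mulnDr.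
have : (#|U| <= m)%N by rewrite -[X in (_ <= X)%N]card_ord max_card.
set u := #|U|; set a := (\sum_(i in U) _)%N; set b := ascents U => le_um.
have [c ->] : exists c, m = (u + c)%N by exists (m - u)%N; lia.
rewrite addKn; nia.
Qed.

Lemma big_card_setU1 (m k : nat) (i : 'I_m) (Q : pred {set 'I_m}) (g : {set 'I_m} -> int) :
  \sum_(S : {set 'I_m} | [&& #|S| == k, i \in S & Q S]) g S =
  \sum_(S : {set 'I_m} | [&& #|S|.+1 == k, i \notin S & Q (i |: S)]) g (i |: S).
Proof.
rewrite (reindex_onto (fun S => i |: S) (fun S => S :\ i)) /=; last first.
  by move=> S /and3P[_ iS _]; rewrite setD1K.
apply: eq_bigl => S; rewrite setU11 /=.
have [iS | iS] := boolP (i \in S).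
  rewrite andbF; apply/negbTE; rewrite negb_and; apply/orP; right.
  by apply/eqP => eqS; move: iS; rewrite -eqS !inE eqxx.
by rewrite cardsU1 iS setU1K // eqxx andbT add1n.
Qed.

(** Split by which of [i], [j] lie in [S]. With both, the term is 0. With neither, it exchanges [j]
    for [i] in [j |: S], of size [k.+1]. In the cases of exactly one, the values at sets containing
    both cancel, leaving exchanges at size [k]. *)
Lemma sum_edge_differences (m k : nat) (i j : 'I_m) (w : {set 'I_m} -> int) :
  i != j ->
  \sum_(S : {set 'I_m} | #|S| == k)
    ((j \notin S)%:R * (w S - w (j |: S)) - (i \notin S)%:R * (w S - w (i |: S))) =
  \sum_(S : {set 'I_m} | [&& #|S| == k.+1, j \in S & i \notin S]) (w (i |: (S :\ j)) - w S) +
  \sum_(S : {set 'I_m} | [&& #|S| == k, j \in S & i \notin S]) (w (i |: (S :\ j)) - w S).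
Proof.
move=> neq_ij.
have split_i (P : pred {set 'I_m}) F : \sum_(S | P S) F S =
    \sum_(S | P S && (i \in S)) F S + \sum_(S | P S && (i \notin S)) F S :> int.
  exact: bigID.
rewrite split_i (bigID (fun S : {set _} => j \in S)) /= [X in X + _ + _]big1 ?add0r; last first.
  by move=> S /andP[/andP[_ ->] ->] /=; rewrite !mul0r subrr.
rewrite [X in _ + X](bigID (fun S : {set _} => j \in S)) /= addrCA addrA addrC; congr (_ + _).
  rewrite big_card_setU1; apply: eq_big => S.
    by rewrite !inE (negPf neq_ij) /= eqSS -!andbA andbCA andbC -andbA.
  by move=> /andP[/andP[_ iS] jS]; rewrite iS jS !mul1r setU1K //; ring.
have -> : \sum_(S : {set 'I_m} | [&& #|S| == k, j \in S & i \notin S]) (w (i |: (S :\ j)) - w S) =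
  \sum_(S : {set 'I_m} | [&& #|S|.+1 == k, i \notin S & j \notin S]) (w (i |: S) - w (j |: S)).
  rewrite big_card_setU1; apply: eq_big => S.
    by rewrite !inE (negPf neq_ij) /= (andbC (j \notin S)).
  by case/and3P=> _ jS _; rewrite setU1K.
have e1 : \sum_(S : {set 'I_m} | (#|S| == k) && (i \in S) && (j \notin S))
     ((j \notin S)%:R * (w S - w (j |: S)) - (i \notin S)%:R * (w S - w (i |: S))) =
  \sum_(S : {set 'I_m} | [&& #|S|.+1 == k, i \notin S & j \notin S]) (w (i |: S) - w (j |: (i |: S))).
  under eq_bigl do rewrite -andbA.
  rewrite (big_card_setU1 _ _ _ (fun S => j \notin S)); apply: eq_big => S.
    by rewrite !inE (eq_sym j) (negPf neq_ij).
  by case/and3P=> _ _ jS; rewrite jS setU11 /= mul1r mul0r subr0.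
have e2 : \sum_(S : {set 'I_m} | (#|S| == k) && (i \notin S) && (j \in S))
     ((j \notin S)%:R * (w S - w (j |: S)) - (i \notin S)%:R * (w S - w (i |: S))) =
  \sum_(S : {set 'I_m} | [&& #|S|.+1 == k, i \notin S & j \notin S]) (w (j |: (i |: S)) - w (j |: S)).
  under eq_bigl do rewrite -andbA (andbC (i \notin _)).
  rewrite (big_card_setU1 _ _ _ (fun S => i \notin S)); apply: eq_big => S.
    by rewrite !inE (negPf neq_ij) /= (andbC (i \notin S)).
  case/and3P=> _ _ iS; rewrite iS setU11 /= mul1r mul0r sub0r opprB.
  by rewrite setUCA.
rewrite e1 e2 -big_split /=; apply: eq_bigr => S _; ring.
Qed.

(* K S stands for the number of flows whose demands are lowered by one on S, and
   W i j S for the total flow they carry on the edge (i, j). *)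
Lemma subset_recurrence (m k : nat) (K : {set 'I_m} -> int)
    (W : 'I_m -> 'I_m -> {set 'I_m} -> int) :
  (forall (i : 'I_m) (S : {set 'I_m}), i \notin S ->
     (m - i)%:Z * (K S - K (i |: S)) =
     \sum_(j : 'I_m | (j < i)%N) (W j i S - W j i (i |: S)) -
     \sum_(j : 'I_m | (i < j)%N) (W i j S - W i j (i |: S))) ->
  (forall (i j : 'I_m) (S : {set 'I_m}), (i < j)%N -> i \notin S -> j \notin S ->
     W i j (i |: S) - W i j (j |: S) = K (j |: S)) ->
  (k < m)%N ->
  ((m - k) * (m - k).+1)%:Z * (\sum_(S : {set 'I_m} | #|S| == k) K S) =
  (k.+1 * (2 * m - k))%:Z * (\sum_(S : {set 'I_m} | #|S| == k.+1) K S).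
Proof.
move=> vertexK edgeW ltkm.
pose d (i : 'I_m) : int := (m - i)%:Z.
(* [A] is computed twice: by vertex weights in [A1], and through conservation, regrouped by edges,
   in [A2] and [A3]. Once both are doubled, the ascent terms agree and drop out. *)
pose A := \sum_(S : {set 'I_m} | #|S| == k) \sum_(i | i \notin S) d i * (K S - K (i |: S)).
have A1 : A = \sum_(S : {set 'I_m} | #|S| == k) (\sum_(i | i \notin S) (m - i))%N%:Z * K S
   - \sum_(S : {set 'I_m} | #|S| == k.+1) (\sum_(i in S) (m - i))%N%:Z * K S.
  have -> : A = \sum_(S : {set 'I_m} | #|S| == k) \sum_(i | i \notin S) d i * K S
      - \sum_(S : {set 'I_m} | #|S| == k) \sum_(i | i \notin S) d i * K (i |: S).
    rewrite -sumrB; apply: eq_bigr => S _; rewrite -sumrB; apply: eq_bigr => i _.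
    by rewrite mulrBr.
  congr (_ - _).
    by apply: eq_bigr => S _; rewrite -mulr_suml; congr (_ * _); rewrite (big_morph Posz PoszD (erefl _)).
  rewrite (exchange_big_dep xpredT) //=.
  have -> : \sum_(S : {set 'I_m} | #|S| == k.+1) (\sum_(i in S) (m - i))%N%:Z * K S =
     \sum_(S : {set 'I_m} | #|S| == k.+1) \sum_(i in S) d i * K S.
    by apply: eq_bigr => S _; rewrite -mulr_suml; congr (_ * _); rewrite (big_morph Posz PoszD (erefl _)).
  rewrite [RHS](exchange_big_dep xpredT) //=; apply: eq_bigr => i _.
  rewrite [RHS](eq_bigl (fun S : {set 'I_m} => [&& #|S| == k.+1, i \in S & true])).
    rewrite (big_card_setU1 _ _ _ xpredT); apply: eq_bigl => S.
    by rewrite andbT eqSS.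
  by move=> S; rewrite andbT.
have A2 : A = \sum_(i : 'I_m) \sum_(j : 'I_m | (i < j)%N)
    \sum_(S : {set 'I_m} | #|S| == k)
     ((j \notin S)%:R * (W i j S - W i j (j |: S)) - (i \notin S)%:R * (W i j S - W i j (i |: S))).
  transitivity (\sum_(S : {set 'I_m} | #|S| == k)
     (\sum_(i : 'I_m) \sum_(j : 'I_m | (i < j)%N) (j \notin S)%:R * (W i j S - W i j (j |: S)) -
      \sum_(i : 'I_m) \sum_(j : 'I_m | (i < j)%N) (i \notin S)%:R * (W i j S - W i j (i |: S)))).
    apply: eq_bigr => S _.
    rewrite (exchange_big_dep xpredT) //= -sumrB big_mkcond /=; apply: eq_bigr => i _.
    case: ifP => iS; last by rewrite !big1 ?subrr // => j _; rewrite mul0r.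
    rewrite vertexK //; congr (_ - _); apply: eq_bigr => j _; by rewrite mul1r.
  under [RHS]eq_bigr do rewrite exchange_big /=.
  rewrite [RHS]exchange_big /=.
  apply: eq_bigr => S _; rewrite -sumrB; apply: eq_bigr => i _; by rewrite -sumrB.
have asc l : \sum_(i : 'I_m) \sum_(j : 'I_m | (i < j)%N)
    \sum_(S : {set 'I_m} | [&& #|S| == l, j \in S & i \notin S]) K S =
    \sum_(S : {set 'I_m} | #|S| == l) (ascents S)%:Z * K S.
  transitivity (\sum_(i : 'I_m) \sum_(j : 'I_m) \sum_(S : {set 'I_m} | #|S| == l)
     (if i \notin S then if j \in S then (i < j)%N%:Z * K S else 0 else 0)).
    apply: eq_bigr => i _; rewrite big_mkcond; apply: eq_bigr => j _.
    case: ltnP => _.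
      rewrite big_mkcondr; apply: eq_bigr => S _.
      by case: (j \in S); case: (i \in S); rewrite //= mul1r.
    by rewrite big1 // => S _; case: ifP => // _; case: ifP => // _; exact: mul0r.
  under eq_bigr do rewrite exchange_big /=.
  rewrite exchange_big; apply: eq_bigr => S _.
  rewrite /ascents (big_morph Posz PoszD (erefl _)) mulr_suml [RHS]big_mkcond.
  apply: eq_bigr => i _; case: ifP => _; last by rewrite big1.
  by rewrite (big_morph Posz PoszD (erefl _)) mulr_suml [RHS]big_mkcond.
have A3 : A = \sum_(S : {set 'I_m} | #|S| == k.+1) (ascents S)%:Z * K S +
    \sum_(S : {set 'I_m} | #|S| == k) (ascents S)%:Z * K S.
  rewrite A2 -!asc -big_split; apply: eq_bigr => i _; rewrite -big_split.
  apply: eq_bigr => j ltij; rewrite sum_edge_differences; last by rewrite -val_eqE /= ltn_eqF.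
  have edgeK (S : {set 'I_m}) : j \in S -> i \notin S -> W i j (i |: (S :\ j)) - W i j S = K S.
    move=> jS iS; rewrite -{2 3}(setD1K jS); apply: edgeW => //.
      by rewrite !inE negb_and iS orbT.
    by rewrite !inE eqxx.
  by congr (_ + _); apply: eq_bigr => S /and3P[_ jS iS]; apply: edgeK.
have wt1 (S : {set 'I_m}) : #|S| = k -> 2 * (\sum_(i | i \notin S) (m - i))%N%:Z =
    ((m - k) * (m - k).+1)%:Z + 2 * (ascents S)%:Z.
  move=> <-; rewrite -[2]/(2%N%:Z) -!PoszM -PoszD.
  by rewrite sum_complement_weights.
have wt2 (S : {set 'I_m}) : #|S| = k.+1 -> 2 * (\sum_(i in S) (m - i))%N%:Z =
    (k.+1 * (2 * m - k))%:Z - 2 * (ascents S)%:Z.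
  move=> cardS; have := sum_weights m S; rewrite cardS.
  have -> : (m + (m - k.+1).+1 = 2 * m - k)%N by clear -ltkm; lia.
  by move=> <-; rewrite mulnDr PoszD !PoszM addrK.
have : 2 * A = 2 * A by [].
rewrite {1}A1 A3 mulrBr mulrDr !mulr_sumr.
rewrite (eq_bigr (fun S : {set 'I_m} => ((m - k) * (m - k).+1)%:Z * K S + 2 * ((ascents S)%:Z * K S))); last first.
  by move=> S /eqP /wt1 eqS; rewrite [LHS]mulrA eqS mulrDl -mulrA.
rewrite [X in _ - X](eq_bigr (fun S : {set 'I_m} => (k.+1 * (2 * m - k))%:Z * K S - 2 * ((ascents S)%:Z * K S))); last first.
  by move=> S /eqP /wt2 eqS; rewrite [LHS]mulrA eqS mulrBl -mulrA.
rewrite big_split sumrB /=.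
set a := \sum_(i0 | _) _; set b := \sum_(i0 | _) _; set c := \sum_(i0 | _) _; set e := \sum_(i0 | _) _.
move=> eqA; apply/eqP; rewrite -subr_eq0; apply/eqP.
lia.
Qed.

(** * The recurrence for flows on the complete graph *)

Lemma big_edges (V : nmodType) (p : nat) (F : nat * nat -> V) :
  \sum_(e <- edges p) F e =
  \sum_(a < p.+1) \sum_(b < p.+1 | (a < b)%N) F (a : nat, b : nat).
Proof.
rewrite /edges big_allpairs_dep -[p.+1 in LHS]subn0 -/(index_iota 0 p.+1) big_mkord.
apply: eq_bigr => a _.
rewrite -(big_mkord (fun b => a < b)%N (fun b => F (a : nat, b))).
rewrite (big_cat_nat (leq0n a.+1) (ltn_ord a)) /= [X in _ = X + _]big_nat_cond.
rewrite [X in _ = X + _]big_pred0 ?add0r; last by move=> b; lia.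
rewrite [RHS]big_nat_cond [RHS](eq_bigl (fun b => (a < b <= p)%N && true)); last first.
  by move=> b; rewrite ltnS andbT; case: (a < b)%N; rewrite ?andbT ?andbF.
by rewrite -[RHS]big_nat_cond /index_iota subSS.
Qed.

Lemma sum_edges_at (m : nat) (i : 'I_m) (F : nat * nat -> int) :
  \sum_(e <- edges m) ((i.+1 == e.2)%:R - (i.+1 == e.1)%:R) * F e =
  F (0, i.+1)%N + \sum_(j < m | (j < i)%N) F (j.+1, i.+1)
  - \sum_(j < m | (i < j)%N) F (i.+1, j.+1).
Proof.
under eq_bigr do rewrite mulrBl.
rewrite sumrB !big_edges; congr (_ - _).
  transitivity (\sum_(a < m.+1 | (a < i.+1)%N) F (a : nat, i.+1)).
    rewrite [RHS]big_mkcond; apply: eq_bigr => a _ /=.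
    rewrite big_mkcond (bigD1 (lift ord0 i)) //= [X in _ + X]big1 ?addr0.
      by rewrite eqxx mul1r.
    move=> b neq; suff /negPf-> : i.+1 != b by rewrite mul0r if_same.
    by apply: contra neq => /eqP eqb; rewrite -val_eqE /= -eqb.
  by rewrite big_mkcond big_ord_recl /= [in RHS]big_mkcond.
transitivity (\sum_(b < m.+1 | (i.+1 < b)%N) F (i.+1, b : nat)); last first.
  by rewrite big_mkcond big_ord_recl /= add0r [in RHS]big_mkcond.
rewrite (bigD1 (lift ord0 i)) //= [X in _ + X]big1 ?addr0.
  by apply: eq_bigr => b _; rewrite eqxx mul1r.
move=> a neq; apply: big1 => b _.
suff /negPf-> : i.+1 != a by rewrite mul0r.
by apply: contra neq => /eqP eqa; rewrite -val_eqE /= -eqa.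
Qed.

(* The ordinal i : 'I_m stands for the vertex i.+1. *)
Definition demand (m : nat) (S : {set 'I_m}) : {poly int} :=
  \sum_(i < m) edge (0, i.+1)%N *+ (m - i) - \sum_(i in S) edge (0, i.+1)%N.

Lemma demandU1 (m : nat) (S : {set 'I_m}) (i : 'I_m) :
  i \notin S -> demand m (i |: S) = demand m S - edge (0, i.+1)%N.
Proof. by move=> iS; rewrite /demand big_setU1 //= opprD addrCA addrC. Qed.

Lemma coef_demand (m : nat) (S : {set 'I_m}) (i : 'I_m) :
  - (demand m S)`_i.+1 = (m - i)%:Z - (i \in S)%:R.
Proof.
have coefE (j : 'I_m) : (edge (0, j.+1)%N)`_i.+1 = - (i == j)%:R.
  by rewrite coef_edge /= sub0r eqSS -val_eqE.
rewrite /demand coefB !coef_sum opprB addrC; congr (_ + _).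
  rewrite -sumrN (bigD1 i) //= big1 ?addr0.
    by rewrite coefMn coefE eqxx mulNrn opprK natz.
  by move=> j /negPf neq; rewrite coefMn coefE eq_sym neq oppr0 mul0rn oppr0.
have [iS|iS] := boolP (i \in S).
  rewrite (bigD1 i) //= big1 ?addr0 ?coefE ?eqxx //.
  by move=> j /andP[_ /negPf neq]; rewrite coefE eq_sym neq oppr0.
rewrite big1 ?oppr0 // => j jS; rewrite coefE.
by case: eqP => [eij|]; rewrite ?oppr0 //; rewrite eij jS in iS.
Qed.

Lemma kpf_subset_recurrence (m k : nat) : (k < m)%N ->
  ((m - k) * (m - k).+1 *
     (\sum_(S : {set 'I_m} | #|S| == k) kpf (map edge (edges m)) (demand m S)) =
   k.+1 * (2 * m - k) *
     (\sum_(S : {set 'I_m} | #|S| == k.+1) kpf (map edge (edges m)) (demand m S)))%N.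
Proof.
move=> ltkm.
pose L := map edge (edges m).
(* The total flow on [e] over all flows with netflow [N], as in [kpf_derivative]. *)
pose w (e : nat * nat) N : int := (kpf (edge e :: L) (N - edge e))%:Z.
have posL : positive L by apply: positive_edges_seq.
have posE (a b : nat) : (a < b)%N -> positive (edge (a, b) :: L).
  by move=> ltab; rewrite /= height_edge posL andbT /= subr_gt0 ltz_nat.
have wB (a b : nat) N : (a < b)%N ->
    w (a, b) N = (kpf L (N - edge (a, b)))%:Z + w (a, b) (N - edge (a, b)).
  by move=> ltab; rewrite /w [in LHS]kpf_cons ?PoszD //; apply: posE.
have balance (S : {set 'I_m}) (i : 'I_m) :
    ((m - i)%:Z - (i \in S)%:R) * (kpf L (demand m S))%:Z =
    w (0, i.+1)%N (demand m S) + \sum_(j < m | (j < i)%N) w (j.+1, i.+1) (demand m S)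
    - \sum_(j < m | (i < j)%N) w (i.+1, j.+1) (demand m S).
  rewrite -coef_demand.
  apply: etrans (sum_edges_at m i (fun e => w e (demand m S))).
  rewrite (kpf_derivative (fun u => - u`_i.+1)) //; last by move=> u v; rewrite coefB opprD.
  by rewrite big_map; apply: eq_bigr => e _; rewrite coef_edge opprB.
suff eqZ : ((m - k) * (m - k).+1)%:Z *
      (\sum_(S : {set 'I_m} | #|S| == k) (kpf L (demand m S))%:Z) =
    (k.+1 * (2 * m - k))%:Z *
      (\sum_(S : {set 'I_m} | #|S| == k.+1) (kpf L (demand m S))%:Z).
  have sumZ (P : pred {set 'I_m}) (F : {set 'I_m} -> nat) :
      (\sum_(S | P S) F S)%N%:Z = \sum_(S | P S) (F S)%:Z.
    exact: (big_morph Posz PoszD).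
  by apply/eqP; rewrite -eqz_nat; apply/eqP; rewrite [LHS]PoszM [RHS]PoszM !sumZ.
apply: (subset_recurrence m k _ (fun i j S => w (i.+1, j.+1) (demand m S))) => //.
- move=> i S iS; rewrite !sumrB demandU1 //.
  (* Passing to [i |: S] lowers the demand at [i.+1] by one and the total on the source edge by the
     count for [i |: S]; these two effects cancel. *)
  have := balance S i; have := balance (i |: S) i.
  rewrite setU11 (negPf iS) demandU1 // subr0 (wB _ _ (demand m S)) //.
  set s1 := \sum_(j0 < m | _) _; set s2 := \sum_(j0 < m | _) _.
  set s3 := \sum_(j0 < m | _) _; set s4 := \sum_(j0 < m | _) _.
  rewrite mulrBl mul1r mulrBr.
  move=> /eqP; rewrite subr_eq => /eqP -> ->; ring.
- move=> i j S ltij iS jS; rewrite !demandU1 // (wB i.+1 j.+1) //.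
  (* A unit along [(0, i.+1)] followed by one along [(i.+1, j.+1)] has the netflow of a unit along
     [(0, j.+1)]. *)
  have -> : demand m S - edge (0, i.+1)%N - edge (i.+1, j.+1) = demand m S - edge (0, j.+1)%N.
    by rewrite /edge /=; ring.
  by rewrite addrK.
Qed.

Lemma kpf_demand_ratio (m : nat) :
  (m.+1 * kpf (map edge (edges m)) (demand m set0) =
   'C(m.*2, m) * kpf (map edge (edges m)) (demand m setT))%N.
Proof.
pose E k := (\sum_(S : {set 'I_m} | #|S| == k) kpf (map edge (edges m)) (demand m S))%N.
have E0 : E 0%N = kpf (map edge (edges m)) (demand m set0).
  by rewrite /E (big_pred1 set0) // => S; rewrite cards_eq0.
have Em : E m = kpf (map edge (edges m)) (demand m setT).
  rewrite /E (big_pred1 setT) // => S /=.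
  by rewrite eqEcard subsetT cardsT card_ord eqn_leq -[X in (_ <= X)%N && _](card_ord m) max_card.
(* The falling factorials are the products of the factors (m-j)(m-j+1) and (j+1)(2m-j) over j <
   k. *)
have tele k : (k <= m)%N -> (m ^_ k * m.+1 ^_ k * E 0 = k`! * (2 * m) ^_ k * E k)%N.
  elim: k => [_|k IHk ltkm]; first by rewrite !ffactn0.
  have := IHk (ltnW ltkm); have := kpf_subset_recurrence m k ltkm; rewrite -/(E k) -/(E k.+1).
  rewrite !ffactnSr factS subSn; last exact: ltnW.
  set x := (m ^_ k)%N; set y := (m.+1 ^_ k)%N; set z := ((2 * m) ^_ k)%N.
  set a := (m - k)%N; set b := (2 * m - k)%N => recE IH.
  transitivity (k`! * z * (a * a.+1 * E k))%N; last by rewrite recE; ring.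
  by transitivity (x * y * E 0 * (a * a.+1))%N; [ring | rewrite IH; ring].
have := tele m (leqnn m); rewrite E0 Em -mul2n ffactnn -(bin_ffact (2 * m) m).
have -> : (m.+1 ^_ m = m.+1 * m`!)%N.
  by have := ffactnn m.+1; rewrite ffactnSr subSnn muln1 factS.
set u := kpf _ _; set v := kpf _ _; set f := m`!.
have f_gt0 : (0 < f)%N by apply: fact_gt0.
move=> eqf; apply/eqP; rewrite -(eqn_pmul2l (m := f * f)); last by rewrite muln_gt0 f_gt0.
by apply/eqP; transitivity (f * (m.+1 * f) * u)%N; [ring | rewrite eqf; ring].
Qed.

(** * Evaluation as a product of Catalan numbers *)

(** The division in [catalan] is exact, with quotient C(2m, m) - C(2m, m+1). *)
Lemma catalanE (m : nat) : (m.+1 * catalan m = 'C(m.*2, m))%N.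
Proof.
rewrite /catalan mulnC divnK //.
have := mul_bin_left m.*2 m; rewrite -addnn addnK => eqC.
have le : ('C(m + m, m.+1) <= 'C(m + m, m))%N by nia.
apply/dvdnP; exists ('C(m + m, m) - 'C(m + m, m.+1))%N; nia.
Qed.

Lemma source_flowE (p : nat) :
  source_flow p = \sum_(a < p.+1) edge (0, a : nat)%N *+ (p - a).
Proof.
rewrite /source_flow /edges big_allpairs_dep -[p.+1 in LHS]subn0.
rewrite -/(index_iota 0 p.+1) big_mkord; apply: eq_bigr => a _.
by rewrite /= big_const_seq count_predT size_iota -Monoid.iteropE.
Qed.

Lemma source_flowS (m : nat) : source_flow m.+1 = demand m set0.
Proof.
rewrite source_flowE big_ord_recl big_ord_recr /= /edge subrr mul0rn add0r.
rewrite /demand big_set0 subr0 /bump /= subSS subnn mulr0n addr0.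
by apply: eq_bigr => i _; rewrite subSS.
Qed.

Lemma source_flow_demand (m : nat) : source_flow m = demand m setT.
Proof.
rewrite source_flowE big_ord_recl /= /edge subrr mul0rn add0r /demand.
rewrite [X in _ - X](eq_bigl xpredT) => [|i]; last by rewrite inE.
rewrite -sumrB; apply: eq_bigr => i _; rewrite /bump /= add1n.
by rewrite -(subnSK (ltn_ord i)) mulrSr addrK.
Qed.

Lemma kpf_source_flow (p : nat) : kpf (map edge (edges p)) (source_flow p) = catalan_prod p.
Proof.
elim: p => [|p IHp].
  by rewrite /source_flow big_nil /catalan_prod big_nil /kpf /= eqxx.
rewrite /catalan_prod big_nat_recr //= -/(catalan_prod p) -IHp.
apply/eqP; rewrite -(eqn_pmul2l (m := p.+1)) //; apply/eqP.
rewrite mulnCA catalanE (source_flow_demand p) [RHS]mulnC -kpf_demand_ratio -source_flowS.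
congr (_ * _)%N.
rewrite (perm_kpf _ _ (positive_edges_seq _) (perm_map edge (perm_edgesS p))).
have permC : perm_eq (map edge (edges p ++ sinks p.+1)) (map edge (sinks p.+1) ++ map edge (edges p)).
  by rewrite map_cat perm_catC.
have posC : positive (map edge (sinks p.+1) ++ map edge (edges p)).
  rewrite /positive -(perm_all _ permC) -(perm_all _ (perm_map edge (perm_edgesS p))).
  exact: (positive_edges_seq p.+1).
have posS : positive (map edge (edges p ++ sinks p.+1)) by rewrite /positive (perm_all _ permC).
rewrite (perm_kpf _ _ posS permC).
have coef_top (e : nat * nat) : (e.1 < e.2 <= p)%N -> - (edge e)`_p.+1 = 0.
  by case: e => i j /= ltij; rewrite coef_edge /= !gtn_eqF ?subrr ?oppr0 //; lia.
(* This functional is the demand at [p.+1]: positive on the edges into that vertex, 0 on the others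
   and on the netflow. *)
apply: (kpf_cat_face (fun u => - u`_p.+1)) => //.
- by move=> u v; rewrite coefB opprD.
- apply/allP => _ /mapP[e /mapP[l lp ->] ->]; rewrite mem_iota in lp.
  by rewrite coef_edge /= eqxx gtn_eqF.
- by apply/allP => x /mapP[e]; rewrite mem_edges => /coef_top ltij ->; rewrite ltij.
- rewrite source_flowE coef_sum big1 ?oppr0 // => a _.
  rewrite coefMn coef_edge /= sub0r; case: eqP => [<-|_]; last by rewrite oppr0 mul0rn.
  by rewrite subnn mulr0n.
Qed.

(** * Comparison of the two binomials *)

(** The ratio of the binomials is (M+1)/(M+1-b), at most (r+1)/r once (r+1)b <= M+1. *)
Lemma bin_ratio_step (r b M : nat) :
  (0 < r)%N -> (r * b + b <= M.+1)%N -> (r * 'C(M.+1, b) <= r.+1 * 'C(M, b))%N.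
Proof.
move=> r_gt0 leM.
have eqM : ('C(M.+1, b) * (M.+1 - b) = M.+1 * 'C(M, b))%N.
  by case: b leM => [|b] leM; [rewrite !bin0 subn0; lia | have := mul_bin_left M.+1 b; have := mul_bin_diag M b; have := mul_bin_left M b; have := binS M b; nia].
have lt_b : (b < M.+1)%N by case: b leM {eqM} => //; nia.
rewrite -(leq_pmul2r (m := M.+1 - b)); last lia.
rewrite -mulnA eqM.
have : (r * M.+1 <= r.+1 * (M.+1 - b))%N by nia.
by move=> le; rewrite mulnA [leqRHS]mulnAC leq_mul2r le orbT.
Qed.

Lemma bin_ratio (k b M : nat) :
  (k.+2 * b <= M.+1)%N -> ('C(M + k, b) <= k.+1 * 'C(M, b))%N.
Proof.
(* Each step costs at most (k+2)/(k+1) <= (k+1-j)/(k-j), and the latter bounds telescope. *)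
move=> leM; suff H j : (j <= k)%N -> ('C(M + j, b) * (k.+1 - j) <= k.+1 * 'C(M, b))%N.
  by have := H k (leqnn k); rewrite subSnn muln1.
elim: j => [|j IHj] ltjk; first by rewrite addn0 subn0 mulnC.
apply: leq_trans (IHj (ltnW ltjk)); rewrite addnS.
have := @bin_ratio_step k.+1 b (M + j) isT; set x := 'C(_.+1, _); set y := 'C(_, _).
move=> /(_ _)H; have {}H : (k.+1 * x <= k.+2 * y)%N by apply: H; nia.
rewrite -(leq_pmul2l (m := k.+1)) //.
have : (k.+2 * (k.+1 - j.+1) <= k.+1 * (k.+1 - j))%N.
  have [d ->] : exists d, k = (j.+1 + d)%N by exists (k - j.+1)%N; lia.
  have -> : ((j.+1 + d).+1 - j.+1 = d.+1)%N by lia.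
  have -> : ((j.+1 + d).+1 - j = d.+2)%N by lia.
  nia.
set a := (k.+1 - j.+1)%N; set c := (k.+1 - j)%N => le_ac.
apply: (@leq_trans (k.+2 * y * a)); first by rewrite mulnA leq_mul2r H orbT.
by rewrite -mulnA mulnCA [leqRHS]mulnCA leq_mul2l le_ac orbT.
Qed.

Lemma bin_fact_ratio (k b M : nat) :
  (k.+2 * b <= M.+1)%N -> ('C(M + 'C(k.+1, 2), b) <= k.+1`! * 'C(M, b))%N.
Proof.
elim: k => [|k IHk] leM; first by rewrite (@bin_small 1 2) // addn0 factS fact0 !mul1n.
rewrite binS bin1 addnA factS -mulnA.
apply: leq_trans (bin_ratio k.+1 b _ _) _; first nia.
by rewrite leq_mul2l /= IHk //; nia.
Qed.

Lemma bin_upper_ratio (n t : nat) :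
  (1 <= n)%N -> (n ^ 3 <= 2 * t)%N ->
  ('C(t + 'C(n, 2), 'C(n, 2)) <= (n - 1)`! * 'C(t + n - 1, 'C(n, 2)))%N.
Proof.
case: n => [//|[|k]] _ le_t; first by rewrite (@bin_small 1 2) // !bin0.
have -> : (t + k.+2 - 1 = t + k.+1)%N by lia.
rewrite (_ : k.+2 - 1 = k.+1)%N //; set b := 'C(k.+2, 2).
have b2 : (2 * b = k.+2 * k.+1)%N.
  have := mul_bin_diag k.+2 1; rewrite bin1 /b; lia.
have -> : (t + b = t + k.+1 + 'C(k.+1, 2))%N.
  by rewrite /b binS bin1; lia.
(* With n = k + 2 this needs n C(n, 2) <= t + n, which holds since n C(n, 2) <= n^3/2 <= t. *)
by apply: bin_fact_ratio; move: le_t; rewrite !expnS expn0; nia.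
Qed.

(** * Enumeration of the flows *)

Definition set_flow {n : nat} (e : 'I_n.+1 * 'I_n.+1) (c : nat) (f : flowvec n) : flowvec n :=
  [ffun x => if x == e then c else f x].

Definition nat_pair {n : nat} (e : 'I_n.+1 * 'I_n.+1) : nat * nat := (e.1 : nat, e.2 : nat).

(** The recursion is that of [kpf], so that the size is [kpf] by construction. *)
Fixpoint enum_flows {n : nat} (E : seq ('I_n.+1 * 'I_n.+1)) (N : {poly int}) : seq (flowvec n) :=
  if E is e :: E' then
    [seq set_flow e c f | c <- iota 0 `|height N|.+1,
                          f <- enum_flows E' (N - edge (nat_pair e) *+ c)]
  else if N == 0 then [:: [ffun => 0%N]] else [::].

Lemma size_enum_flows (n : nat) (E : seq ('I_n.+1 * 'I_n.+1)) (N : {poly int}) :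
  size (enum_flows E N) = kpf (map edge (map nat_pair E)) N.
Proof.
elim: E N => [|e E IHE] N; first by rewrite /kpf /=; case: eqP.
rewrite [LHS]size_allpairs_dep sumnE big_map -[X in iota 0 X]subn0.
rewrite -/(index_iota 0 _) big_mkord.
by apply: eq_bigr => c _; apply: IHE.
Qed.

Lemma mem_enum_flows (n : nat) (E : seq ('I_n.+1 * 'I_n.+1)) (N : {poly int}) (f : flowvec n) :
  uniq E -> all (fun e : 'I_n.+1 * 'I_n.+1 => (e.1 < e.2)%N) E ->
  f \in enum_flows E N <->
  (forall x, x \notin E -> f x = 0%N) /\ \sum_(e <- E) edge (nat_pair e) *+ f e = N.
Proof.
elim: E N f => [|e E IHE] N f.
  move=> _ _; rewrite big_nil /= eq_sym; case: eqP => [eqN|neq]; last by split=> // -[_ /neq].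
  rewrite inE; split=> [/eqP->|[f0 _]]; first by split=> // x _; rewrite ffunE.
  by apply/eqP/ffunP => x; rewrite ffunE f0.
case/andP=> eE uniqE /andP[lte ltE].
have sum_set c g : \sum_(x <- e :: E) edge (nat_pair x) *+ set_flow e c g x =
    edge (nat_pair e) *+ c + \sum_(x <- E) edge (nat_pair x) *+ g x.
  rewrite big_cons ffunE eqxx; congr (_ + _); apply: eq_big_seq => x xE.
  by rewrite ffunE; case: eqP => // eqx; rewrite -eqx xE in eE.
split=> [/allpairsPdep[c [g [_ /(IHE _ _ uniqE ltE)[g0 sumg] ->]]]|[f0 sumf]].
  split; last by rewrite sum_set sumg addrC subrK.
  by move=> x; rewrite inE negb_or ffunE => /andP[/negPf-> /g0].
have f_set : f = set_flow e (f e) (set_flow e 0%N f).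
  by apply/ffunP => x; rewrite !ffunE; case: eqP => [->|].
rewrite f_set sum_set in sumf.
have heightD u v : height (u + v) = height u + height v.
  by rewrite /height derivD hornerD opprD.
apply/allpairsPdep; exists (f e), (set_flow e 0%N f); split=> //.
(* [f e] stays within the enumerated range: the rest of the sum has nonnegative height, and the edge
   has height at least 1. *)
- rewrite mem_iota /= add0n ltnS.
  have := heightB N (edge (nat_pair e) *+ f e).
  rewrite -{1}sumf addrC addKr.
  have : 0 <= height (\sum_(x <- E) edge (nat_pair x) *+ set_flow e 0%N f x).
    rewrite big_seq; apply: (big_ind (fun u => 0 <= height u)).
    + by rewrite /height deriv0 horner0 oppr0.
    + by move=> u v; rewrite heightD; apply: addr_ge0.
    + move=> x xE; rewrite heightMn height_edge mulr_ge0 // subr_ge0 lez_nat.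
      exact: ltnW (allP ltE x xE).
  by rewrite heightMn height_edge /=; nia.
- apply/(IHE _ _ uniqE ltE); split; last by rewrite -sumf addrC addKr.
  move=> x xE; rewrite ffunE; case: eqP => // neq; apply: f0.
  by rewrite inE negb_or xE andbT; apply/eqP.
Qed.

Lemma uniq_enum_flows (n : nat) (E : seq ('I_n.+1 * 'I_n.+1)) (N : {poly int}) :
  uniq E -> all (fun e : 'I_n.+1 * 'I_n.+1 => (e.1 < e.2)%N) E -> uniq (enum_flows E N).
Proof.
elim: E N => [|e E IHE] N; first by rewrite /=; case: ifP.
case/andP=> eE uniqE /andP[lte ltE].
apply: allpairs_uniq_dep; first exact: iota_uniq.
  by move=> c _; apply: IHE.
(* Flows enumerated for the tail vanish at [e], so [c] and [f] can be recovered from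
   [set_flow e c f]. *)
have at_e c (f : flowvec n) :
    f \in enum_flows E (N - edge (nat_pair e) *+ c) -> f e = 0%N.
  by case/(mem_enum_flows _ _ _ _ uniqE ltE) => f0 _; apply: f0.
move=> _ _ /allpairsPdep[c [f [_ /at_e f0 ->]]] /allpairsPdep[d [g [_ /at_e g0 ->]]].
move=> /= /ffunP eqfg.
have eqcd : c = d by have := eqfg e; rewrite !ffunE eqxx.
have eqf : f = g.
  apply/ffunP => x; have := eqfg x; rewrite !ffunE; case: eqP => // -> _.
  by rewrite f0 g0.
by rewrite eqcd eqf.
Qed.

Definition flow_support (n : nat) : seq ('I_n.+1 * 'I_n.+1) :=
  [seq e : 'I_n.+1 * 'I_n.+1 <- enum {: 'I_n.+1 * 'I_n.+1} | (e.1 < e.2)%N].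

Lemma perm_flow_support (n : nat) : perm_eq (map nat_pair (flow_support n)) (edges n).
Proof.
apply: uniq_perm; last first.
- move=> [i j]; rewrite mem_edges /=; apply/mapP/idP => [[[a b]]|/andP[ltij lejn]].
    by rewrite mem_filter /= => /andP[ltab _] [-> ->]; rewrite ltab /= -ltnS ltn_ord.
  have ltin : (i < n.+1)%N by lia.
  exists (Ordinal ltin, Ordinal (lejn : (j < n.+1)%N)) => //.
  by rewrite mem_filter /= ltij mem_enum.
- exact: uniq_edges.
rewrite map_inj_uniq; first by apply/filter_uniq/enum_uniq.
by move=> [a b] [c d] [/val_inj -> /val_inj ->].
Qed.

Lemma coef_flow_sum (n : nat) (f : flowvec n) (i : 'I_n.+1) :
  (\sum_(e <- flow_support n) edge (nat_pair e) *+ f e)`_i =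
  (\sum_(j : 'I_n.+1 | (i < j)%N) (f (i, j))%:Z)
  - (\sum_(k : 'I_n.+1 | (k < i)%N) (f (k, i))%:Z).
Proof.
rewrite coef_sum big_filter big_enum_cond /=.
have -> : \sum_(e : 'I_n.+1 * 'I_n.+1 | (e.1 < e.2)%N) (edge (nat_pair e) *+ f e)`_i =
  \sum_(a < n.+1) \sum_(b < n.+1 | (a < b)%N) ((a == i)%:R * (f (a, b))%:Z - (b == i)%:R * (f (a, b))%:Z).
  rewrite (pair_big_dep xpredT (fun a b : 'I_n.+1 => (a < b)%N)) /=.
  apply: eq_big => [[a b] //|[a b] _] /=.
  by rewrite coefMn coef_edge /= -(mulr_natr (_ - _)) mulrBl !val_eqE !(eq_sym i) !natz.
transitivity (\sum_(a < n.+1) (\sum_(b < n.+1 | (a < b)%N) (a == i)%:R * (f (a, b))%:Z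
    - \sum_(b < n.+1 | (a < b)%N) (b == i)%:R * (f (a, b))%:Z)).
  by apply: eq_bigr => a _; rewrite sumrB.
rewrite sumrB; congr (_ - _).
  rewrite (bigD1 i) //= [X in _ + X]big1 ?addr0.
    by apply: eq_bigr => b _; rewrite eqxx mul1r.
  by move=> a /negPf neq; apply: big1 => b _; rewrite neq mul0r.
rewrite (exchange_big_dep xpredT) //= (bigD1 i) //= [X in _ + X]big1 ?addr0.
  by apply: eq_bigr => b _; rewrite eqxx mul1r.
by move=> a /negPf neq; apply: big1 => b _; rewrite neq mul0r.
Qed.

Lemma is_flow_enum (n t : nat) (f : flowvec n) : (0 < n)%N ->
  is_flow (@netflow_t n t%:Z) f <->
  f \in enum_flows (flow_support n) (edge (0, n)%N *+ t).
Proof.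
move=> n_gt0.
have uniqS : uniq (flow_support n) by apply/filter_uniq/enum_uniq.
have ltS : all (fun e : 'I_n.+1 * 'I_n.+1 => (e.1 < e.2)%N) (flow_support n).
  exact: filter_all.
have netE (i : 'I_n.+1) : (edge (0, n)%N *+ t)`_i = @netflow_t n t%:Z i.
  rewrite coefMn coef_edge /netflow_t /=; case: (eqVneq (i : nat) 0%N) => [->|_].
    by rewrite (ltn_eqF n_gt0) subr0 natz.
  by case: eqP => _; rewrite sub0r ?mulNrn ?natz ?oppr0 ?mul0rn.
rewrite mem_enum_flows //; split=> -[f0 flowN]; split.
- move=> [i j]; rewrite mem_filter /= mem_enum andbT; exact: f0.
- apply/polyP => l; have [lel | ltl] := leqP l n.
    have -> : l = (Ordinal (lel : (l < n.+1)%N) : nat) by [].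
    by rewrite coef_flow_sum netE -flowN.
  (* Above degree [n] both polynomials have zero coefficients. *)
  rewrite coefMn coef_edge /= !gtn_eqF ?subrr ?mul0rn //; last by lia.
  rewrite coef_sum big1 // => e _; rewrite coefMn coef_edge /=.
  by rewrite !gtn_eqF ?subrr ?mul0rn //; apply: leq_trans ltl; apply: ltn_ord.
- by move=> i j; have := f0 (i, j); rewrite mem_filter /= mem_enum andbT.
- by move=> i; rewrite -coef_flow_sum flowN netE.
Qed.

(* a_n(t) = K_n(t,0,...,0,-t) is the size of any duplicate-free enumeration of
   the flows; the statement asserts such a (finite) enumeration exists and
   its size satisfies the bounds.  Note t >= n^3/2 > 0, so t is a natural. *)
Theorem theorem1p7 (n : nat) (t : nat) :
  (1 <= n)%N -> (n ^ 3 <= 2 * t)%N ->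
  exists s : seq (flowvec n),
    enumerates_flows ((@netflow_t n t%:Z)) s /\
    ('C(t + n - 1, 'C(n, 2)) * catalan_prod (n - 1) <= size s)%N /\
    (size s <= factorial (n - 1) * 'C(t + n - 1, 'C(n, 2)) * catalan_prod (n - 1))%N.
Proof.
move=> n_gt0 le_t; have ratio := bin_upper_ratio n t n_gt0 le_t.
exists (enum_flows (flow_support n) (edge (0, n)%N *+ t)); split.
  split; last by move=> f; apply: is_flow_enum.
  by apply: uniq_enum_flows; [apply/filter_uniq/enum_uniq | apply: filter_all].
rewrite size_enum_flows.
have posS : positive (map edge (map nat_pair (flow_support n))).
  by rewrite /positive (perm_all _ (perm_map edge (perm_flow_support n))); apply: (positive_edges_seq n).
rewrite (perm_kpf _ _ posS (perm_map edge (perm_flow_support n))).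
case: n n_gt0 ratio {le_t posS} => // p _ ratio.
have /andP[lower upper] := kpf_edges_bounds p t.
rewrite kpf_source_flow in lower upper.
rewrite addnS subn1 /= in ratio *; rewrite subn1 /= in ratio *.
split=> //; apply: leq_trans upper _.
by rewrite leq_mul2r ratio orbT.
Qed.
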